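(* Let $G$ be a periodic nilpotent group. Then $G$ contains a solution of every (possibly infinite) unimodular system of equations over $G$ if and only if only finitely many $p$-components of $G$ have nontrivial first Ulm factor and each of these first Ulm factors has bounded period.
   Context: An equation over a group $G$ in variables $\{x_j\}_{j\in J}$ is an expression $w=1$ with $w$ an element of the free product $G * F(\{x_j\}_{j\in J})$, where $F$ is the free group on the $x_j$ (so coefficients from $G$ are allowed). A system of equations $\{w_i=1\}_{i\in I}$ may have infinitely many equations and infinitely many variables. $G$ contains a solution of the system if there are elements $g_j\in G$ such that substituting $x_j\mapsto g_j$ makes every $w_i$ equal to $1$ in $G$. For each equation $w_i$, form the row whose $j$-th entry is the exponent sum of $x_j$ in $w_i$ (e.g. the exponent sum of $y$ in $x^2y^{-3}g_1xy^2xy^2x^{-1}y^{-2}g_2$ is $-1$). The system is $p$-nonsingular ($p$ prime) if these rows are linearly independent over the field $\mathbb Z_p$ of order $p$ (for infinitely many rows: every finite subset is linearly independent), and unimodular if it is $p$-nonsingular for every prime $p$. For a periodic nilpotent group $G$, its $p$-component is the subgroup of elements of $p$-power order. For a nilpotent $p$-group $P$, the height of $g\in P$ is the greatest $n$ with $g=h^{p^n}$ for some $h\in P$; if no greatest such $n$ exists, $g$ has infinite height. The elements of infinite height form a normal subgroup $P_0$, and the first Ulm factor of $P$ is $P/P_0$. A group has bounded period if there is $n\ge1$ with $g^n=1$ for all its elements $g$. *)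

(* Defs.v *)
From HB Require Import structures.
From mathcomp Require Import all_boot all_order all_algebra.
From mathcomp Require Import monoid.
From Stdlib Require Import ClassicalEpsilon.
Set Implicit Arguments.
Unset Strict Implicit.
Unset Printing Implicit Defensive.

(* A letter of a word in the free product G * F(J):
   a coefficient from G, or a variable x_j (inv = false) or x_j^-1 (inv = true). *)
Inductive letter (G J : Type) : Type :=
| Coef of G
| Var of J & bool.
Arguments Coef {G J} _.
Arguments Var {G J} _ _.

(* Every element of G * F(J) is represented by such a word; evaluation and
   exponent sums only depend on the element represented. *)
Definition word (G J : Type) := seq (letter G J).

Section Equations.
Local Open Scope group_scope.
Variables (G : groupType) (J : Type).

Definition letter_eval (s : J -> G) (l : letter G J) : G :=
  match l with
  | Coef g => g
  | Var j false => s j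
  | Var j true => (s j)^-1
  end.

Definition word_eval (s : J -> G) (w : word G J) : G :=
  foldr (fun l acc => letter_eval s l * acc) 1 w.
End Equations.

Section ExpSum.
Local Open Scope ring_scope.
Variables (G J : Type).

Definition letter_exp (l : letter G J) (j : J) : int :=
  match l with
  | Coef _ => 0
  | Var j' b =>
      if excluded_middle_informative (j' = j) then (if b then -1 else 1) else 0
  end.

Definition expsum (w : word G J) (j : J) : int :=
  foldr (fun l acc => letter_exp l j + acc) 0 w.
End ExpSum.

(* The system {sys i = 1}_{i in I} is p-nonsingular: every finite family of
   distinct rows (exponent-sum vectors) is linearly independent over Z_p,
   i.e. an integer combination vanishing mod p has all coefficients = 0 mod p. *)
Definition p_nonsingular (G I J : Type) (p : nat) (sys : I -> word G J) : Prop :=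
  forall (n : nat) (f : 'I_n -> I), injective f ->
  forall c : 'I_n -> int,
    (forall j : J, (p%:Z %| (\sum_(k < n) c k * expsum (sys (f k)) j)%R)%Z) ->
    forall k : 'I_n, (p%:Z %| c k)%Z.

Definition unimodular (G I J : Type) (sys : I -> word G J) : Prop :=
  forall p : nat, prime p -> p_nonsingular p sys.

Definition has_solution (G : groupType) (I J : Type) (sys : I -> word G J) : Prop :=
  exists s : J -> G, forall i : I, word_eval s (sys i) = 1%g.

Section GroupNotions.
Local Open Scope group_scope.
Variable G : groupType.

Fixpoint upper_central (n : nat) : G -> Prop :=
  match n with
  | 0 => fun g => g = 1
  | n'.+1 => fun g => forall x : G, upper_central n' [~ g, x]
  end.

Definition nilpotent_group : Prop := exists c : nat, forall g : G, upper_central c g.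

Definition periodic_group : Prop := forall g : G, exists n : nat, (0 < n)%N /\ g ^+ n = 1.

Definition in_pcomp (p : nat) (g : G) : Prop := exists k : nat, g ^+ (p ^ k) = 1.

Definition inf_height (p : nat) (g : G) : Prop :=
  forall n : nat, exists h : G, in_pcomp p h /\ g = h ^+ (p ^ n).

(* the first Ulm factor P/P_0 of the p-component P is nontrivial *)
Definition ulm_nontrivial (p : nat) : Prop :=
  exists g : G, in_pcomp p g /\ ~ inf_height p g.

Definition ulm_bounded (p : nat) : Prop :=
  exists n : nat, (0 < n)%N /\ forall g : G, in_pcomp p g -> inf_height p (g ^+ n).
End GroupNotions.

(* Main.v *)
(* For necessity, solve x_n = b_n x_{n+1}^(m_n) for n = 0, 1, ...  In a periodic
   nilpotent group every element commutes with all m-th powers for some m > 0,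
   so the m_n can be chosen with x_0 = u_n x_n^(Q_n), Q_n = m_0 ... m_{n-1},
   where u_n commutes with all Q_n-th powers.  If no power map sends G into the
   elements having roots of all degrees, then b_n and m_n can moreover be chosen
   so that u_{n+1}^(n+1) is not an m_n-th power, which prevents x_0^(n+1) = 1.
   Hence g^n has roots of all degrees for some n > 0 and all g.

   For sufficiency, there is N > 0 such that every g^N has roots of all degrees
   of the form h^N; such elements are central, so D = {g^N} is a divisible
   central subgroup, and G/D is nilpotent of exponent dividing N.  A solution
   modulo L is lifted along central factors L/K of prime exponent, and finally
   from D to 1: the correction solves a linear system over L/K, that is, it
   extends a homomorphism from the span of the rows to all vectors, which is possible
   over Z/p by nonsingularity mod p and over Z by divisibility. *)
Require Import Defs.
From HB Require Import structures.
From mathcomp Require Import all_boot all_order all_algebra.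
From mathcomp Require Import monoid generic_quotient.
From mathcomp Require Import boolp classical_sets functions.

Set Implicit Arguments.
Unset Strict Implicit.
Unset Printing Implicit Defensive.

(** * Commutators and powers in nilpotent groups *)


Section NormalSubgroups.
Local Open Scope group_scope.
Variable G : groupType.
Implicit Types (K L : G -> Prop) (x y z g h : G).

Record normal_subgroup K : Prop := NormalSubgroup {
  normal1 : K 1;
  normalM : forall g h, K g -> K h -> K (g * h);
  normalV : forall g, K g -> K g^-1;
  normalJ : forall g x, K g -> K (g ^ x) }.

(** For normal [K], the preimage in [G] of the centre of [G/K]; iterating it gives the upper central
    series above [K]. *)
Definition central_mod K g : Prop := forall x, K [~ g, x].

Lemma commMg g h x : [~ g * h, x] = [~ g, x] ^ h * [~ h, x].
Proof. by rewrite !commgEl !conjgE !invgM !mulgA !mulgK. Qed.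

Lemma commgM g x y : [~ g, x * y] = [~ g, y] * [~ g, x] ^ y.
Proof. by rewrite !commgEl !conjgE !invgM !mulgA !mulgK. Qed.

Lemma commVg g x : [~ g^-1, x] = ([~ g, x] ^ g^-1)^-1.
Proof. by rewrite -conjVg invgR conjgE invgK /commg !conjgE !mulgA mulgK invgK. Qed.

Lemma normalX K g n : normal_subgroup K -> K g -> K (g ^+ n).
Proof.
move=> nK Kg; elim: n => [|n IH]; first by rewrite expg0; exact: normal1.
by rewrite expgS; apply: normalM.
Qed.

Lemma central_mod_normal K : normal_subgroup K -> normal_subgroup (central_mod K).
Proof.
move=> nK; split=> [x|g h Cg Ch x|g Cg x|g y Cg x].
- by rewrite comm1g; exact: normal1.
- by rewrite commMg; apply: normalM => //; apply: normalJ.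
- by rewrite commVg; apply: normalV => //; apply: normalJ.
- by rewrite -[x](conjgKV y) -conjRg; apply: normalJ.
Qed.

Lemma sub_central_mod K g : normal_subgroup K -> K g -> central_mod K g.
Proof.
by move=> nK Kg x; rewrite commgEl; apply: normalM => //; [apply: normalV | apply: normalJ].
Qed.

Lemma iter_central_mod_normal K i :
  normal_subgroup K -> normal_subgroup (iter i central_mod K).
Proof. by move=> nK; elim: i => //= i; apply: central_mod_normal. Qed.

Lemma trivial_normal : normal_subgroup (fun g : G => g = 1).
Proof. by split=> // [_ _ -> ->|_ ->|_ x ->]; rewrite ?mulg1 ?invg1 ?conj1g. Qed.

Lemma upper_centralE i : upper_central i = iter i central_mod (fun g : G => g = 1).
Proof. by elim: i => //= i ->. Qed.


(** Congruence modulo [K] is written as membership of a quotient in [K], so that no quotient group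
    has to be formed. *)
Lemma commXg_mod K g x n : normal_subgroup K -> central_mod K [~ g, x] ->
  K ([~ g, x] ^- n * [~ g ^+ n, x]).
Proof.
move=> nK; set z := [~ g, x] => Cz; elim: n => [|n IH].
  by rewrite !expg0 comm1g mulVg; apply: normal1.
rewrite (expgS g) commMg (expgS z) invgM -/z.
(* Conjugating [z] by [g ^+ n] costs only the commutator [[~ z, g ^+ n]], which lies in [K]. *)
have -> : z ^- n / z * (z ^ (g ^+ n) * [~ g ^+ n, x])
        = [~ z, g ^+ n] ^ (z ^+ n) * (z ^- n * [~ g ^+ n, x]).
  by rewrite (commgEl z) [_ ^ (z ^+ n)]conjgE !mulgA !mulgK.
by apply: normalM => //; apply: normalJ.
Qed.

Lemma commgX_mod K g x n : normal_subgroup K -> central_mod K [~ g, x] ->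
  K ([~ g, x] ^- n * [~ g, x ^+ n]).
Proof.
move=> nK; set z := [~ g, x] => Cz; elim: n => [|n IH].
  by rewrite !expg0 commg1 mulVg; apply: normal1.
rewrite (expgSr x) commgM (expgS z) invgM -/z.
have -> : z ^- n / z * (z * [~ g, x ^+ n] ^ x)
        = [~ z ^+ n, x] * (z ^- n * [~ g, x ^+ n]) ^ x.
  by rewrite -[LHS]mulgA mulKg (commgEl (z ^+ n)) (conjMg (z ^- n)) (conjVg (z ^+ n))
    -[RHS]mulgA mulVKg.
apply: normalM => //; last exact: normalJ.
exact: (normalX n (central_mod_normal nK) Cz).
Qed.

(** Modulo [K], both [[~ g ^+ q, x]] and [[~ g, x ^+ q]] equal [[~ g, x] ^+ q]. *)
Lemma commXg_central_mod K g x q : normal_subgroup K -> central_mod K [~ g, x] ->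
  x ^+ q = 1 -> K [~ g ^+ q, x].
Proof.
move=> nK Cz xq.
have := commgX_mod q nK Cz; rewrite xq commg1 mulg1 => /(normalV nK); rewrite invgK => Kzq.
by rewrite -[X in K X](mulVKg ([~ g, x] ^+ q)); apply: normalM => //; apply: commXg_mod.
Qed.

(** Each further [q]-th power moves the commutator with [x] one step down the upper central
    series. *)
Lemma commute_expg_order c g x q : (forall y, upper_central c y) -> x ^+ q = 1 ->
  commute (g ^+ (q ^ c)) x.
Proof.
move=> Gc xq; apply/commgP/eqP.
suff comm_mod i j : i + j = c ->
    iter i central_mod (fun y : G => y = 1) [~ g ^+ (q ^ j), x].
  exact: (comm_mod 0).
elim: j i => [|j IH] i ijc; first by rewrite -upper_centralE -(addn0 i) ijc.
rewrite expnSr expgnA; apply: commXg_central_mod => //.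
  exact/iter_central_mod_normal/trivial_normal.
by have := IH i.+1; rewrite addSnnS; apply.
Qed.
End NormalSubgroups.

(** * Necessity *)


Section ChainSystem.
Variable G : groupType.
Variables (b : nat -> G) (m : nat -> nat).

(* x_n^-1 b_n x_(n+1)^(m_n) *)
Definition chain_system (n : nat) : word G nat :=
  [:: Var n true, Coef (b n) & nseq (m n) (Var n.+1 false)].

Lemma word_eval_chain (s : nat -> G) n :
  word_eval s (chain_system n) = ((s n)^-1 * (b n * s n.+1 ^+ m n))%g.
Proof.
rewrite /chain_system /= /word_eval /=; congr (_ * (_ * _))%g.
by elim: (m n) => [|k IH] //=; rewrite expgS IH.
Qed.

Local Open Scope ring_scope.
Import GRing.Theory.

Lemma expsum_chain n j :
  expsum (chain_system n) j = (n.+1 == j)%:Z *+ m n - (n == j)%:Z.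
Proof.
rewrite /chain_system /expsum /= add0r addrC; congr (_ + _).
  elim: (m n) => [|k IH] /=; first by rewrite mulr0n.
  rewrite IH mulrS; congr (_ + _).
  by case: ClassicalEpsilon.excluded_middle_informative => /= [/eqP->|/eqP/negbTE->]; rewrite ?eqxx.
by case: ClassicalEpsilon.excluded_middle_informative => /= [/eqP->|/eqP/negbTE->];
  rewrite ?eqxx ?oppr0.
Qed.

(** The matrix is triangular with -1 on the diagonal: besides row n, only row n-1 can meet column
    n. *)
Lemma chain_system_unimodular : unimodular chain_system.
Proof.
move=> p _ n f f_inj c pS k.
(* The induction is on the index [f k] of the equation, since [f] need not be increasing. *)
elim/ltn_ind: {k}(f k) {-2}k (erefl (f k)) => t IH k def_t.
have := pS (f k); rewrite (bigD1 k) // expsum_chain eqxx.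
have -> : (f k).+1 == f k = false by rewrite gtn_eqF.
rewrite mul0rn sub0r mulrN1 rpredDr ?rpredN // rpred_sum // => i ik.
rewrite expsum_chain; have /negbTE-> : f i != f k by rewrite (inj_eq f_inj).
rewrite subr0; case: eqP => [fik|_]; last by rewrite mul0rn mulr0 dvdz0.
by apply: dvdz_mulr; apply: IH erefl; rewrite -def_t -fik.
Qed.
End ChainSystem.

(** * Choosing the coefficients and exponents of the chain *)

Section Necessity.
Local Open Scope group_scope.
Variable G : groupType.

(** Roots of different degrees need not be compatible, so no divisible subgroup containing [g] is
    claimed. *)
Definition inf_divisible (g : G) : Prop := forall N, (0 < N)%N -> exists h, g = h ^+ N.

Lemma inf_divisibleX g n : inf_divisible g -> inf_divisible (g ^+ n).
Proof. by move=> divg N /divg[h ->]; exists (h ^+ n); rewrite expgnAC. Qed.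

Hypotheses (perG : periodic_group G) (nilG : nilpotent_group G).

Lemma exp_commute (x : G) : exists m, (0 < m)%N /\ forall y, commute (y ^+ m) x.
Proof.
have [c Gc] := nilG; have [q [q_gt0 xq]] := perG x.
by exists (q ^ c)%N; split=> [|y]; [rewrite expn_gt0 q_gt0 | apply: commute_expg_order].
Qed.

(* The state is (u_n, Q_n), with k = n + 1; the step produces (b_n, m_n). *)
Lemma chain_step k (st : G * nat) : (forall n, (0 < n)%N -> exists g, ~ inf_divisible (g ^+ n)) ->
  exists bm : G * nat, (0 < k)%N -> (0 < st.2)%N -> (forall x, commute (x ^+ st.2) st.1) ->
  [/\ (0 < bm.2)%N, forall x, commute (x ^+ bm.2) bm.1,
      forall x, commute (x ^+ bm.2) (st.1 * bm.1 ^+ st.2)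
    & forall x, (st.1 * bm.1 ^+ st.2) ^+ k <> x ^+ bm.2].
Proof.
case: st => u Q /= unbdd.
(* The conditions on the state stand inside the existential, so that choice gives a total step
   function; bad states get a dummy value. *)
have [[/andP[k_gt0 Q_gt0] comQ]|H] :=
  pselect (((0 < k) && (0 < Q))%N /\ forall x, commute (x ^+ Q) u); last first.
  by exists (1, 0%N) => k_gt0 Q_gt0 comQ; case: H; rewrite k_gt0 Q_gt0.
have [r [r_gt0 ur]] := perG u.
(* As [u] commutes with [b ^+ Q] and [u ^+ r = 1], this power of [b] is the [r]-th power of
   [(u * b ^+ Q) ^+ k], which therefore lacks a root of some degree [N]. *)
have [b b_ndiv] := unbdd (Q * k * r)%N ltac:(by rewrite !muln_gt0 Q_gt0 k_gt0).
have [N [N_gt0 v_ndiv]] : exists N, (0 < N)%N /\ forall x, (u * b ^+ Q) ^+ k <> x ^+ N.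
  apply: contrapT => v_div; apply: b_ndiv.
  have -> : b ^+ (Q * k * r) = ((u * b ^+ Q) ^+ k) ^+ r.
    rewrite !expgMn; try by apply/commute_sym; do ?apply: commuteX.
      by rewrite expgnAC ur expg1n mul1g !expgnA.
    by apply: commuteX2; apply/commute_sym.
  apply: inf_divisibleX => M M_gt0; apply: contrapT => nM; apply: v_div.
  by exists M; split=> // x vx; apply: nM; exists x.
have [m1 [m1_gt0 com1]] := exp_commute b.
have [m2 [m2_gt0 com2]] := exp_commute (u * b ^+ Q).
(* [N] excludes the root, [m1] gives commutation with [b], and [m2] with the new [u]. *)
exists (b, (N * (m1 * m2))%N) => _ _ _; split=> /= [|x|x|x].
- by rewrite !muln_gt0 N_gt0 m1_gt0.
- by rewrite mulnA mulnAC expgnA.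
- by rewrite mulnA expgnA.
- by rewrite mulnC expgnA.
Qed.

Lemma solvable_bounded :
  (forall sys : nat -> word G nat, unimodular sys -> has_solution sys) ->
  exists n, (0 < n)%N /\ forall g, inf_divisible (g ^+ n).
Proof.
move=> solG; apply: contrapT => bdd.
have unbdd n : (0 < n)%N -> exists g, ~ inf_divisible (g ^+ n).
  move=> n_gt0; apply: contrapT => div; apply: bdd; exists n; split=> // g.
  by apply: contrapT => ndiv; apply: div; exists g.
have [F HF] := choice (fun kst => chain_step kst.1 kst.2 unbdd).
pose st := fix st n := if n is n'.+1 then
  let bm := F (n, st n') in ((st n').1 * bm.1 ^+ (st n').2, ((st n').2 * bm.2)%N) else (1, 1%N).
have stS n : st n.+1 = ((st n).1 * (F (n.+1, st n)).1 ^+ (st n).2,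
                        ((st n).2 * (F (n.+1, st n)).2)%N) by [].
have st_inv n : (0 < (st n).2)%N /\ forall x, commute (x ^+ (st n).2) (st n).1.
  elim: n => [|n [Q_gt0 comQ]]; first by split=> // x; apply: commute1.
  have [] := HF (n.+1, st n) => // m_gt0 _ com_m _.
  by rewrite stS; split=> [|x] /=; [rewrite muln_gt0 Q_gt0 | rewrite expgnA].
have [s s_sol] := solG _ (@chain_system_unimodular G (fun n => (F (n.+1, st n)).1)
                                    (fun n => (F (n.+1, st n)).2)).
have s0 n : s 0 = (st n).1 * s n ^+ (st n).2.
  elim: n => [|n IH]; first by rewrite mul1g.
  have [Q_gt0 comQ] := st_inv n.
  have [] := HF (n.+1, st n) => // _ com_b _ _.
  have := s_sol n; rewrite word_eval_chain => /mulg1_eq; rewrite invgK => sn.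
  rewrite IH stS /= {1}sn expgMn ?mulgA; last exact/commute_sym.
  by rewrite -expgnA (mulnC (st n).2).
(* If [k.+1] kills [s 0], the contradiction comes from step [k], which was run with exponent
   [k.+1]. *)
have [n [n_gt0 s0k]] := perG (s 0); case: n n_gt0 s0k => // k _.
have [Q_gt0 comQ] := st_inv k; have [_ comQ'] := st_inv k.+1.
have [] := HF (k.+1, st k) => // _ _ _ /= ndiv.
rewrite (s0 k.+1) expgMn; last exact/commute_sym.
move=> /eqP; rewrite mulg_eq1 => /eqP sk.
(* The new Q is the old one times m_k, so the inverse of the power of [s k.+1] is an m_k-th
   power. *)
apply: (ndiv ((s k.+1)^-1 ^+ ((st k).2 * k.+1))).
by rewrite -expgnA mulnAC expgnA expVgn expVgn.
Qed.
End Necessity.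

(** * Extension of homomorphisms *)


Section HomExtension.
Local Open Scope ring_scope.
Local Open Scope classical_set_scope.
Import GRing.Theory.
Variables M A : zmodType.
Implicit Types (R : set (M * A)) (x y : M) (a b : A).

(** The graph of a homomorphism from a subgroup of [M] to [A]. Closure under differences reduces
    single-valuedness to the value at 0. *)
Record hom_graph R : Prop := HomGraph {
  graph0 : R (0, 0);
  graphB : forall x y a b, R (x, a) -> R (y, b) -> R (x - y, a - b);
  graph_fun : forall a, R (0, a) -> a = 0 }.

Section GraphTheory.
Variables (R : set (M * A)) (homR : hom_graph R).

Lemma graphN x a : R (x, a) -> R (- x, - a).
Proof. by move=> Rx; rewrite -[- x]sub0r -[- a]sub0r; apply: graphB => //; apply: graph0. Qed.

Lemma graphD x y a b : R (x, a) -> R (y, b) -> R (x + y, a + b).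
Proof. by move=> Rx /graphN Ry; rewrite -[y]opprK -[b]opprK; apply: graphB. Qed.

Lemma graphMz x a k : R (x, a) -> R (x *~ k, a *~ k).
Proof.
move=> Rx; have RMn n : R (x *+ n, a *+ n).
  by elim: n => [|n IH]; [rewrite !mulr0n; apply: graph0 | rewrite !mulrS; apply: graphD].
case: k => n; first exact: RMn.
by rewrite NegzE !mulrNz; apply: graphN; apply: RMn.
Qed.

Lemma graph_inj x a b : R (x, a) -> R (x, b) -> a = b.
Proof.
move=> Rxa Rxb; apply/eqP; rewrite -subr_eq0; apply/eqP/(graph_fun homR).
by rewrite -[X in (X, _)](subrr x); apply: graphB.
Qed.

(** Division by [n] leaves a multiple of [x] in the domain that is smaller than the least positive
    one, so the remainder is 0. *)
Lemma graph_multiples x n a c : (0 < n)%N -> R (x *+ n, a) -> a = c *+ n ->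
    (forall k, (0 < k < n)%N -> forall b, ~ R (x *+ k, b)) ->
  forall k b, R (x *~ k, b) -> b = c *~ k.
Proof.
move=> n_gt0 Rxn def_a minn k b Rxk; rewrite {a}def_a in Rxn.
have Rr : R (x *~ (k %% n)%Z, b - c *+ n *~ (k %/ n)%Z).
  have -> : (k %% n)%Z = k - (k %/ n)%Z * n by rewrite {2}(divz_eq k n) addrC addKr.
  rewrite mulrzBr [_ * _]mulrC mulrzA; apply: graphB => //.
  exact: (graphMz (k %/ n)%Z Rxn).
have r_lt : ((k %% n)%Z < n) by apply: ltz_pmod.
have r_ge : (0 <= (k %% n)%Z) by apply: modz_ge0; rewrite eqz_nat -lt0n.
case def_r : (k %% n)%Z => [[|r]|r] in Rr r_lt r_ge *; last by [].
  have /(graph_fun homR)/subr0_eq-> := Rr.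
  by rewrite {2}(divz_eq k n) def_r addr0 mulrC mulrzA.
by case: (minn r.+1 _ _ Rr).
Qed.

Lemma graph_extend x c : (forall k b, R (x *~ k, b) -> b = c *~ k) ->
  exists R', [/\ hom_graph R', R `<=` R' & R' (x, c)].
Proof.
move=> Rx; exists [set p | exists y a k, R (y, a) /\ p = (y + x *~ k, a + c *~ k)].
split=> [|[y a] Ry|].
- split.
  + by exists 0, 0, 0; split; [apply: graph0 | rewrite !mulr0z !addr0].
  + move=> _ _ _ _ [y [a [k [Ry [-> ->]]]]] [z [b [l [Rz [-> ->]]]]].
    exists (y - z), (a - b), (k - l); split; first exact: graphB.
    by rewrite !mulrzBr !opprD (addrACA y) (addrACA a).
  + move=> _ [y [a [k [Ry [yk ->]]]]].
    move: Ry; have -> : y = x *~ (- k) by apply/eqP; rewrite mulrNz -addr_eq0 -yk.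
    by move=> /Rx->; rewrite mulrNz addNr.
- by exists y, a, 0; rewrite !mulr0z !addr0.
- by exists 0, 0, 1; split; [apply: graph0 | rewrite !mulr1z !add0r].
Qed.
End GraphTheory.

(** A maximal graph above [R0] is total. Divisibility is asked only at least positive multiples in
    domains of graphs above [R0], so the lemma serves both divisible groups and groups of prime
    exponent. *)
Lemma hom_extension (R0 : set (M * A)) : hom_graph R0 ->
    (forall R x n a, hom_graph R -> R0 `<=` R -> (0 < n)%N -> R (x *+ n, a) ->
       (forall k, (0 < k < n)%N -> forall b, ~ R (x *+ k, b)) ->
     exists c, a = c *+ n) ->
  exists phi : M -> A, {morph phi : x y / x - y} /\ forall x a, R0 (x, a) -> phi x = a.
Proof.
move=> homR0 ext; (* [set0] is allowed because of the empty chain. *)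
pose P R := R = set0 \/ hom_graph R /\ R0 `<=` R.
have [|R [[R_eq0|[homR R0R]] maxR]] := @Zorn_bigcup _ P.
- move=> F FP totF; have [F0|] := pselect (forall R, F R -> R = set0).
    by left; rewrite -subset0 => p [R /F0->].
  move=> /existsNP[R1 /not_implyP[FR1 R1_neq0]]; right.
  have homF R p : F R -> R p -> hom_graph R /\ R0 `<=` R by move=> /FP[->|].
  have [/R1_neq0 //|[homR1 R0R1]] := FP _ FR1.
  split; last by move=> p /R0R1 R1p; exists R1.
  split=> [|x y a b [X FX Xx] [Y FY Yy]|a [X FX X0]].
  + by exists R1 => //; apply: graph0.
  + have [[homX _] [homY _]] := (homF _ _ FX Xx, homF _ _ FY Yy).
    by have [XY|YX] := totF _ _ FX FY; [exists Y | exists X] => //;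
      apply: graphB => //; [apply: XY | apply: YX].
  + by have [homX _] := homF _ _ FX X0; apply: (graph_fun homX).
- have [] := maxR R0; last by right; split.
  by rewrite R_eq0; split=> // /(_ _ (graph0 homR0)).
have totR x : exists a, R (x, a).
  have [c Rc] : exists c, forall k b, R (x *~ k, b) -> b = c *~ k.
    have [exn|noexn] := pselect (exists n, (0 < n)%N && `[< exists a, R (x *+ n, a) >]).
      case: (ex_minnP exn) => n /andP[n_gt0 /asboolP[a Rxn]] min_n.
      have minn k : (0 < k < n)%N -> forall b, ~ R (x *+ k, b).
        move=> /andP[k_gt0]; rewrite ltnNge => /negP k_lt_n b Rxk; apply/k_lt_n/min_n.
        by rewrite k_gt0; apply/asboolP; exists b.
      have [c def_a] := ext _ _ _ _ homR R0R n_gt0 Rxn minn.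
      by exists c; apply: (graph_multiples homR n_gt0 Rxn def_a minn).
    (* No positive multiple of [x] is in the domain, so any value would do. *)
    exists 0 => k b; rewrite mul0rz.
    have no_mul n d : ~ R (x *+ n.+1, d).
      by move=> Rd; apply: noexn; exists n.+1; apply/asboolP; exists d.
    case: k => [[|n]|n] Rxk; first exact: (graph_fun homR).
      by case: (no_mul _ _ Rxk).
    by have := graphN homR Rxk; rewrite NegzE mulrNz opprK => /no_mul.
  have [R' [homR' RR' R'x]] := graph_extend homR Rc.
  exists c; apply: contrapT => nRx; case: (maxR R'); last first.
    by right; split=> // p /R0R /RR'.
  by split=> // /(_ _ R'x).
have [phi Rphi] := choice totR.
exists phi; split=> [x y|x a /R0R Rxa]; last exact: (graph_inj homR (Rphi x)).
by apply: (graph_inj homR (Rphi _)); apply: graphB.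
Qed.
End HomExtension.

(** * Linear systems *)


Section LinearSystems.
Local Open Scope ring_scope.
Local Open Scope classical_set_scope.
Import GRing.Theory Num.Theory.

Definition lin_letter (G J : Type) (M : zmodType) (y : J -> M) (l : letter G J) : M :=
  match l with Coef _ => 0 | Var j b => if b then - y j else y j end.

(** The linear form in [y] whose coefficients are the exponent sums; recursion on the word avoids a
    sum over an infinite [J]. *)
Definition lin (G J : Type) (M : zmodType) (y : J -> M) (w : word G J) : M :=
  foldr (fun l acc => lin_letter y l + acc) 0 w.

Lemma lin_morph (G J : Type) (M A : zmodType) (phi : M -> A) (y : J -> M) (w : word G J) :
  {morph phi : x y / x - y} -> phi (lin y w) = lin (phi \o y) w.
Proof.
move=> phiB; have phi0 : phi 0 = 0 by rewrite -(subrr 0) phiB subrr.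
have phiN x : phi (- x) = - phi x by rewrite -sub0r phiB phi0 sub0r.
elim: w => //= l w IH; rewrite -[in LHS](opprK (lin y w)) phiB phiN opprK IH.
by case: l => [g|j []] //=; rewrite ?phi0 ?phiN.
Qed.

(** The unit vectors of the full product Z^J, in which the rows live. *)
Definition unit_row (J : Type) (j : J) : J -> int :=
  fun j' => if ClassicalEpsilon.excluded_middle_informative (j = j') then 1 else 0.

Lemma expsum_lin (G J : Type) (w : word G J) : expsum w = lin (@unit_row J) w.
Proof.
apply: funext => j; elim: w => //= l w ->; congr (_ + _).
by case: l => [g|j' []] //=; rewrite ?opprfctE /unit_row;
  case: ClassicalEpsilon.excluded_middle_informative => _ /=; rewrite ?oppr0.
Qed.

Lemma nonsingular_seq (G J : Type) (I : eqType) (p : nat) (sys : I -> word G J)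
    (U : seq I) (C : I -> int) : p_nonsingular p sys -> uniq U ->
    (forall j, (p %| \sum_(i <- U) C i * expsum (sys i) j)%Z) ->
  forall i, i \in U -> (p %| C i)%Z.
Proof.
move=> nsing uU dvdU i /(nthP i)[k k_lt <-].
have f_inj : injective (tnth (in_tuple U)) by apply/tuple_uniqP.
have := nsing _ _ f_inj (fun k => C (tnth (in_tuple U) k)) _ (Ordinal k_lt).
rewrite (tnth_nth i) /=; apply=> j.
by move: (dvdU j); rewrite [in X in X -> _]big_tnth.
Qed.

(** Descent at 2: the coefficients of an integral relation are even, and halving them gives another
    relation, so every power of 2 divides them. *)
Lemma nonsingular_int (G J : Type) (I : eqType) (sys : I -> word G J)
    (U : seq I) (C : I -> int) : p_nonsingular 2 sys -> uniq U ->
    (forall j, \sum_(i <- U) C i * expsum (sys i) j = 0) ->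
  forall i, i \in U -> C i = 0.
Proof.
move=> nsing uU sumC0 i iU.
have dvd2X k (B : I -> int) : (forall j, \sum_(i <- U) B i * expsum (sys i) j = 0) ->
    ((2 ^ k)%N %| B i)%Z.
  elim: k => [|k IH] in B *; first by rewrite dvd1z.
  move=> sumB0; have dvdB : forall i, i \in U -> (2 %| B i)%Z.
    by apply: (nonsingular_seq nsing) => // j; rewrite sumB0 dvdz0.
  have -> : B i = (B i %/ 2)%Z * 2%:Z by rewrite divzK ?dvdB.
  rewrite expnSr PoszM dvdz_mul2r //; apply: (IH (fun i => B i %/ 2)%Z) => j.
  apply: (@mulIf _ 2%:Z) => //; rewrite mul0r mulr_suml -[RHS](sumB0 j).
  by apply: eq_big_seq => l lU; rewrite mulrAC divzK ?dvdB.
apply/eqP; rewrite -absz_eq0; apply/negPn; rewrite -lt0n; apply/negP => C_gt0.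
have := dvd2X `|C i|%N C sumC0; rewrite dvdzE /= => /(dvdn_leq C_gt0).
by rewrite leqNgt ltn_expl.
Qed.

(* Nonsingularity speaks of distinct rows, whereas [s] may repeat an equation. *)
Lemma regroup (I : eqType) (V : zmodType) (v : I -> V) (s : seq (int * I)) :
  \sum_(t <- s) v t.2 *~ t.1 =
  \sum_(i <- undup (map snd s)) v i *~ (\sum_(t <- s | t.2 == i) t.1).
Proof.
have -> : \sum_(t <- s) v t.2 *~ t.1 =
    \sum_(t <- s) \sum_(i <- undup (map snd s) | t.2 == i) v i *~ t.1.
  apply: eq_big_seq => t ts; rewrite big_mkcond /= (bigD1_seq t.2) ?undup_uniq //=; last first.
    by rewrite mem_undup; apply: map_f.
  by rewrite eqxx big1 ?addr0 // => i /negbTE; rewrite eq_sym => ->.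
rewrite (exchange_big_dep predT) //=; apply: eq_bigr => i _.
by rewrite mulrz_sumr.
Qed.

Lemma fctMn (J : Type) (V : zmodType) (f : J -> V) n j : (f *+ n) j = f j *+ n.
Proof. by elim: n => [|n IH]; rewrite ?mulr0n // !mulrS addrfctE /= IH. Qed.

Lemma fctMz (J : Type) (V : zmodType) (f : J -> V) k j : (f *~ k) j = f j *~ k.
Proof.
case: k => n; first exact: fctMn.
by rewrite !NegzE !mulrNz opprfctE; congr (- _); apply: fctMn.
Qed.

(** Sending row i to [b i] is well defined on the span of the rows and extends to a homomorphism on
    Z^J, whose values at the unit vectors are the solution. The value [q = 0] marks the divisible
    case. *)
Lemma linear_system_solvable (G J : Type) (I : eqType) (A : zmodType) (q : nat)
    (sys : I -> word G J) (b : I -> A) : unimodular sys ->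
    (prime q /\ (forall a : A, a *+ q = 0)) \/
    (q = 0%N /\ forall (a : A) n, (0 < n)%N -> exists c, a = c *+ n) ->
  exists y : J -> A, forall i, lin y (sys i) = b i.
Proof.
move=> uni qA; pose row i : J -> int := lin (@unit_row J) (sys i).
(* Multiples of [q] are sent to 0, as the exponent of [A] forces; for [q = 0] they add nothing. *)
pose R0 := [set p : (J -> int) * A | exists (s : seq (int * I)) (m : J -> int),
  p = (\sum_(t <- s) row t.2 *~ t.1 + m *+ q, \sum_(t <- s) b t.2 *~ t.1)].
have fctE (U : seq I) (C : I -> int) j :
    (\sum_(i <- U) row i *~ C i) j = \sum_(i <- U) C i * expsum (sys i) j.
  rewrite fct_sumE; apply: eq_bigr => i _.
  by rewrite fctMz mulrzz mulrC expsum_lin.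
have homR0 : hom_graph R0.
  split.
  - by exists [::], 0; rewrite !big_nil mul0rn addr0.
  - move=> _ _ _ _ [s [m [-> ->]]] [s' [m' [-> ->]]].
    have sumN (V : zmodType) (v : I -> V) :
        \sum_(t <- [seq (- t.1, t.2) | t <- s']) v t.2 *~ t.1 = - \sum_(t <- s') v t.2 *~ t.1.
      by rewrite big_map -sumrN; apply: eq_bigr => t _; rewrite mulrNz.
    exists (s ++ [seq (- t.1, t.2) | t <- s']), (m - m').
    by rewrite !big_cat !sumN mulrnBl opprD addrACA.
  - move=> _ [s [m [sum0 ->]]]; rewrite regroup.
    pose C i := \sum_(t <- s | t.2 == i) t.1; set U := undup (map snd s).
    have sumC j : \sum_(i <- U) C i * expsum (sys i) j = - (m j *+ q).
      apply/eqP; rewrite -addr_eq0 -fctE -fctMn -regroup.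
      apply/eqP; exact: (esym (congr1 (@^~ j) sum0)).
    (* A relation modulo [q] has coefficients divisible by [q], or zero if [q = 0], so each term
       vanishes in [A]. *)
    rewrite big_seq big1 // => i iU; rewrite -/(C i).
    case: qA => [[q_pr qA]|[q0 _]].
      have /dvdzP[d ->] : (q %| C i)%Z.
        apply: (nonsingular_seq (uni q q_pr) (undup_uniq _) _ iU) => j.
        by rewrite sumC rpredN -mulr_natr natz dvdz_mull.
      by rewrite mulrC mulrzA -pmulrn qA mul0rz.
    suff -> : C i = 0 by rewrite mulr0z.
    apply: (nonsingular_int (uni 2 isT) (undup_uniq _) _ iU) => j.
    by rewrite sumC q0 oppr0.
have R0q m : R0 (m *+ q, 0) by exists [::], m; rewrite !big_nil add0r.
have [|phi [phiB phiR0]] := hom_extension homR0.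
  move=> R x n a homR R0R n_gt0 Rxn minn; case: qA => [[q_pr qA]|[_ /(_ a n n_gt0) //]].
  (* By minimality [n] divides [q], since [x *+ q] is in the domain; for [n = q] the value there is
     already 0. *)
  have q_n : (n %| q)%N.
    rewrite /dvdn; apply: contrapT => /negP; rewrite -lt0n => r_gt0.
    apply: (minn (q %% n)%N _ (0 - a *~ (q %/ n)%N)); first by rewrite r_gt0 ltn_mod.
    have -> : x *+ (q %% n) = x *+ q - x *+ n *~ (q %/ n)%N.
      by rewrite {2}(divn_eq q n) mulrnDr mulnC mulrnA addrC addKr.
    by apply: (graphB homR); [apply/R0R/R0q | apply: graphMz].
  have /primeP[_ /(_ n q_n)/orP[/eqP n1|/eqP nq]] := q_pr.
    by exists a; rewrite n1.
  exists 0; rewrite mul0rn; apply: (graph_inj homR Rxn).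
  by rewrite nq; apply/R0R/R0q.
exists (phi \o @unit_row J) => i; rewrite -lin_morph //; apply: phiR0.
by exists [:: (1, i)], 0; rewrite !big_seq1 mul0rn addr0.
Qed.
End LinearSystems.

(** * Lifting solutions along central factors *)


Section CentralQuotient.
Local Open Scope group_scope.
Local Open Scope quotient_scope.
Variables (G : groupType) (K L : G -> Prop).
Hypotheses (nK : normal_subgroup K) (nL : normal_subgroup L).
Hypothesis centL : forall g, L g -> central_mod K g.

(* Sending the elements outside [L] to [1] presents [L/K] as a quotient of the whole type [G]. *)
Definition clip (g : G) : G := if `[< L g >] then g else 1.

Lemma clipL g : L (clip g).
Proof. by rewrite /clip; case: asboolP => // _; apply: normal1. Qed.

Lemma clip_id g : L g -> clip g = g.
Proof. by rewrite /clip; case: asboolP. Qed.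

Definition coset_rel (g h : G) : bool := `[< K ((clip g)^-1 * clip h) >].

Lemma coset_rel_refl : reflexive coset_rel.
Proof. by move=> g; apply/asboolP; rewrite mulVg; apply: normal1. Qed.

Lemma coset_rel_sym : symmetric coset_rel.
Proof.
suff sub g h : coset_rel g h -> coset_rel h g by move=> g h; apply/idP/idP; apply: sub.
by move=> /asboolP/(normalV nK); rewrite invgM invgK => Kgh; apply/asboolP.
Qed.

Lemma coset_rel_trans : transitive coset_rel.
Proof.
move=> h g k /asboolP Kgh /asboolP Khk; apply/asboolP.
by rewrite -(mulVKg (clip h) (clip k)) mulgA; apply: normalM.
Qed.

Canonical coset_equiv := EquivRel coset_rel coset_rel_refl coset_rel_sym coset_rel_trans.

Definition coset := {eq_quot coset_rel}.
HB.instance Definition _ := Choice.on coset.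
HB.instance Definition _ := EqQuotient.on coset.

Implicit Types a b : coset.

Definition coset_add a b : coset := \pi_coset (clip (repr a) * clip (repr b)).
Definition coset_opp a : coset := \pi_coset (clip (repr a))^-1.

Lemma eq_pi g h : L g -> L h -> \pi_coset g = \pi_coset h <-> K (g^-1 * h).
Proof.
by move=> Lg Lh; split=> [/eqmodP/asboolP|Kgh];
  [|apply/eqmodP/asboolP]; rewrite !clip_id.
Qed.

Lemma pi_clip g : \pi_coset (clip g) = \pi_coset g.
Proof. by apply/eqmodP/asboolP; rewrite (clip_id (clipL g)) mulVg; apply: normal1. Qed.

Lemma cosetP a : exists2 g, L g & a = \pi_coset g.
Proof. by exists (clip (repr a)); [apply: clipL | rewrite pi_clip reprK]. Qed.

Lemma coset_addE g h : L g -> L h -> coset_add (\pi_coset g) (\pi_coset h) = \pi_coset (g * h).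
Proof.
move=> Lg Lh; apply/eq_pi; [by apply: normalM; try apply: clipL | exact: normalM |].
have Kg : K ((clip (repr (\pi_coset g)))^-1 * g).
  by apply/eq_pi => //; [apply: clipL | rewrite pi_clip reprK].
have Kh : K ((clip (repr (\pi_coset h)))^-1 * h).
  by apply/eq_pi => //; [apply: clipL | rewrite pi_clip reprK].
move: (clip (repr (\pi_coset g))) (clip (repr (\pi_coset h))) Kg Kh => g' h' Kg Kh.
have -> : (g' * h')^-1 * (g * h) = (g'^-1 * g) ^ h' * (h'^-1 * h).
  by rewrite invgM conjgE !mulgA mulgK.
by apply: normalM => //; apply: normalJ.
Qed.

Lemma coset_addA : associative coset_add.
Proof.
move=> a b c; have [[[x Lx ->] [y Ly ->]] [z Lz ->]] := (cosetP a, cosetP b, cosetP c).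
by rewrite !coset_addE ?mulgA //; apply: normalM.
Qed.

Lemma coset_addC : commutative coset_add.
Proof.
move=> a b; have [[x Lx ->] [y Ly ->]] := (cosetP a, cosetP b).
rewrite !coset_addE //; apply/eq_pi; try exact: normalM.
by rewrite invgM -mulgA; apply: (centL Ly).
Qed.

Lemma coset_add0 : left_id (\pi_coset 1) coset_add.
Proof.
by move=> a; have [x Lx ->] := cosetP a; rewrite coset_addE ?mul1g //; apply: normal1.
Qed.

Lemma coset_addN : left_inverse (\pi_coset 1) coset_opp coset_add.
Proof.
move=> a; rewrite -{2}[a]reprK -(pi_clip (repr a)) coset_addE ?mulVg //; last exact: clipL.
by apply: normalV => //; apply: clipL.
Qed.

HB.instance Definition _ := GRing.isZmodule.Build coset
  coset_addA coset_addC coset_add0 coset_addN.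

(** Hides the construction of [L/K]: later arguments use only these properties of [phi] on [L]. *)
Lemma central_quotient : exists (A : zmodType) (phi : G -> A),
  [/\ forall g h, L g -> L h -> phi (g * h) = (phi g + phi h)%R,
      forall g, L g -> (phi g = 0%R <-> K g)
    & forall u, exists2 g, L g & u = phi g].
Proof.
exists coset, (\pi_coset); split=> [g h Lg Lh|g Lg|u]; last exact: cosetP.
  by rewrite -coset_addE.
have L1 := normal1 nL; split=> [/esym/(eq_pi L1 Lg)|Kg]; first by rewrite invg1 mul1g.
by apply/esym/(eq_pi L1 Lg); rewrite invg1 mul1g.
Qed.
End CentralQuotient.

(** * Correcting a solution by elements of a central factor *)

Section Lifting.
Local Open Scope group_scope.
Variables (G : groupType) (J : Type).
Implicit Types (K L : G -> Prop).

(** Collecting the corrections on the right conjugates them, which [phi] does not see; their total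
    is thus linear in [d]. *)
Lemma word_eval_twist (L : G -> Prop) (A : zmodType) (phi : G -> A) (s d : J -> G) (w : word G J) :
    normal_subgroup L -> (forall g h, L g -> L h -> phi (g * h) = (phi g + phi h)%R) ->
    (forall g x, L g -> phi (g ^ x) = phi g) -> (forall j, L (d j)) ->
  exists e, [/\ L e, word_eval (fun j => s j * d j) w = word_eval s w * e
    & phi e = lin (phi \o d) w].
Proof.
move=> nL phiM phiJ Ld.
have phi1 : phi 1 = 0%R.
  by apply: (@GRing.addrI _ (phi 1)); rewrite GRing.addr0 -phiM ?mulg1 //; apply: normal1.
have phiV g : L g -> phi g^-1 = (- phi g)%R.
  move=> Lg; apply: (@GRing.addrI _ (phi g)).
  by rewrite GRing.subrr -phiM ?mulgV //; apply: normalV.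
elim: w => [|l w [e [Le eval_w phi_e]]] /=.
  by exists 1; split; [apply: normal1 | rewrite mulg1 |].
have [f [Lf eval_l phi_f]] : exists f, [/\ L f,
    letter_eval (fun j => s j * d j) l = letter_eval s l * f & phi f = lin_letter (phi \o d) l].
  case: l => [g|j []] /=.
  - by exists 1; split; [apply: normal1 | rewrite mulg1 |].
  - exists ((d j)^-1 ^ (s j)^-1); split; first by apply: normalJ => //; apply: normalV.
      by rewrite invgM conjgE invgK mulKg.
    by rewrite phiJ ?phiV //; apply: normalV.
  - by exists (d j).
exists (f ^ word_eval s w * e); split.
- by apply: normalM => //; apply: normalJ.
- by rewrite eval_w eval_l -[in RHS]mulgA conjgE !mulgA mulgK.
- by rewrite phiM ?phiJ ?phi_f ?phi_e //; apply: normalJ.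
Qed.

Lemma morph_expg L (A : zmodType) (phi : G -> A) : normal_subgroup L ->
    (forall g h, L g -> L h -> phi (g * h) = (phi g + phi h)%R) ->
  forall g n, L g -> phi (g ^+ n) = (phi g *+ n)%R.
Proof.
move=> nL phiM g n Lg; elim: n => [|n IH].
  by apply: (@GRing.addrI _ (phi 1)); rewrite GRing.addr0 -phiM ?mulg1 //; apply: normal1.
by rewrite expgS GRing.mulrS phiM ?IH //; apply: normalX.
Qed.

(** Replacing [s] by [s j * d j] with [d j] in [L] turns the lifting into a linear system over
    [L/K], with the negated error of [s] as right-hand side. *)
Lemma lift_solution (I : eqType) (sys : I -> word G J) K L (q : nat) :
    normal_subgroup K -> normal_subgroup L -> (forall g, K g -> L g) ->
    (forall g, L g -> central_mod K g) -> unimodular sys ->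
    (prime q /\ forall g, L g -> K (g ^+ q)) \/
    (q = 0 /\ forall g n, L g -> 0 < n -> exists2 h, L h & g = h ^+ n) ->
    (exists s, forall i, L (word_eval s (sys i))) ->
  exists s, forall i, K (word_eval s (sys i)).
Proof.
move=> nK nL KL centL uni qL [s s_sol].
have [A [phi [phiM phi0 phi_surj]]] := central_quotient nK nL centL.
have phiX := morph_expg nL phiM.
have phiJ g x : L g -> phi (g ^ x) = phi g.
  move=> Lg; rewrite -[g ^ x](mulVKg g) -commgEl phiM //; last exact/KL/centL.
  by have /phi0-> := centL _ Lg x; rewrite ?GRing.addr0 //; apply/KL/centL.
have [|y y_sol] := linear_system_solvable (q := q) (fun i => (- phi (word_eval s (sys i)))%R) uni.
  case: qL => [[q_pr Lq]|[-> divL]]; [left; split=> // a | right; split=> // a n n_gt0].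
    by have [g Lg ->] := phi_surj a; rewrite -phiX //; apply/phi0; [apply: normalX | apply: Lq].
  have [g Lg ->] := phi_surj a; have [h Lh ->] := divL _ _ Lg n_gt0.
  by exists (phi h); rewrite phiX.
have /choice[d dP] j : exists g, L g /\ y j = phi g.
  by have [g Lg yj] := phi_surj (y j); exists g.
exists (fun j => s j * d j) => i.
have [e [Le -> phi_e]] := word_eval_twist s (sys i) nL phiM phiJ (fun j => (dP j).1).
apply/phi0; first exact: normalM.
rewrite phiM // phi_e.
have -> : phi \o d = y by apply: funext => j; rewrite /= -(dP j).2.
by rewrite y_sol GRing.subrr.
Qed.

Lemma lift_solution_exponent (I : eqType) (sys : I -> word G J) K L (N : nat) :
    normal_subgroup K -> normal_subgroup L -> (forall g, K g -> L g) ->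
    (forall g, L g -> central_mod K g) -> unimodular sys ->
    0 < N -> (forall g, L g -> K (g ^+ N)) ->
    (exists s, forall i, L (word_eval s (sys i))) ->
  exists s, forall i, K (word_eval s (sys i)).
Proof.
move=> nK nL KL centL uni; elim/ltn_ind: N => N IH in L nL KL centL *.
move=> N_gt0 LN [s s_sol].
have [N_le1|N_gt1] := leqP N 1.
  have N1 : N = 1%N by apply/eqP; rewrite eqn_leq N_le1.
  by exists s => i; have := LN _ (s_sol i); rewrite N1 expg1.
pose p := pdiv N; have p_pr : prime p := pdiv_prime N_gt1.
have def_N : N = (p * (N %/ p))%N by rewrite mulnC divnK ?pdiv_dvd.
set N' := (N %/ p)%N in def_N.
have N'_gt0 : 0 < N' by move: N_gt0; rewrite def_N muln_gt0 => /andP[].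
(* [L/L'] has exponent dividing [p], and [L'/K] exponent dividing [N'], where the induction
   applies. *)
pose L' g := L g /\ K (g ^+ N').
have nL' : normal_subgroup L'.
  have [A [phi [phiM phi0 _]]] := central_quotient nK nL centL.
  have phiX := morph_expg nL phiM.
  split=> [|g h [Lg Kg] [Lh Kh]|g [Lg Kg]|g x [Lg Kg]].
  - by split; [|rewrite expg1n]; apply: normal1.
  - split; first exact: normalM.
    have Lgh : L (g * h) by apply: normalM.
    apply/phi0; first exact: normalX.
    rewrite phiX ?phiM //.
    by rewrite GRing.mulrnDl -!phiX //; move/phi0: Kg => ->; first (move/phi0: Kh => ->);
       rewrite ?GRing.addr0 //; apply: normalX.
  - by split; [|rewrite expVgn]; apply: normalV.
  - by split; [|rewrite -conjXg]; apply: normalJ.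
apply: (IH N' _ L' nL') => //.
- by rewrite ltn_Pdiv ?prime_gt1.
- by move=> g Kg; split; [apply: KL | apply: normalX].
- by move=> g [Lg _]; apply: centL.
- by move=> g [].
apply: (lift_solution (L := L) (q := p)) => //; last by exists s.
- by move=> g [].
- by move=> g Lg x; have Kgx := centL g Lg x; split; [apply: KL | apply: normalX].
- by left; split=> // g Lg; split; [apply: normalX | rewrite -expgnA -def_N; apply: LN].
Qed.
End Lifting.

(** * Ulm factors and the divisible part *)


Section UlmFactors.
Local Open Scope group_scope.
Variable G : groupType.
Implicit Types (g h x : G) (p : nat).

Lemma coprime_root g a b : g ^+ a = 1 -> coprime a b -> 0 < b -> exists h, g = h ^+ b.
Proof.
move=> ga co_ab b_gt0; have [u v uv _] := egcdnP a b_gt0.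
exists (g ^+ u); rewrite -expgnA uv expgnDr mulnC expgnA ga expg1n mul1g.
by rewrite gcdnC (eqP co_ab).
Qed.

Lemma in_pcompX p g n : in_pcomp p g -> in_pcomp p (g ^+ n).
Proof. by move=> [k gk]; exists k; rewrite expgnAC gk expg1n. Qed.

Lemma inf_heightX p g n : inf_height p g -> inf_height p (g ^+ n).
Proof.
move=> hg k; have [h [ph ->]] := hg k; exists (h ^+ n); split; first exact: in_pcompX.
by rewrite expgnAC.
Qed.

(** The [p]-part of the degree comes from the height; the part prime to [p] from Bezout in a cyclic
    [p]-group. *)
Lemma inf_height_divisible p g : prime p -> inf_height p g -> inf_divisible g.
Proof.
move=> p_pr hg K K_gt0; have [m co_pm ->] := pfactor_coprime p_pr K_gt0.
have [s [[k sk] ->]] := hg (logn p K).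
have [||t ->] := @coprime_root s (p ^ k) m sk.
  exact: coprimeXl.
  by case: m co_pm => //; rewrite /coprime gcdn0 => /eqP p1; rewrite p1 in p_pr.
by exists t; rewrite expgnA.
Qed.

Lemma inf_divisible_height p g : prime p -> in_pcomp p g -> inf_divisible g -> inf_height p g.
Proof.
move=> p_pr [k gk] divg n; have [|h gh] := divg (p ^ n)%N; first by rewrite expn_gt0 prime_gt0.
by exists h; split=> //; exists (n + k)%N; rewrite expnD expgnA -gh.
Qed.

(** If [p] does not divide [N], every element of [p]-power order is an [N]-th power, hence of
    infinite height. *)
Lemma bounded_ulm N : 0 < N -> (forall g, inf_divisible (g ^+ N)) ->
  (exists s : seq nat, forall p, prime p -> ulm_nontrivial G p -> p \in s) /\
  (forall p, prime p -> ulm_nontrivial G p -> ulm_bounded G p).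
Proof.
move=> N_gt0 divN; split.
  exists (primes N) => p p_pr [g [[k gk] hg]]; rewrite mem_primes p_pr N_gt0 /=.
  apply: contrapT => /negP p_N; apply: hg.
  apply: inf_divisible_height => //; first by exists k.
  by have [|//|h ->] := coprime_root (b := N) gk; rewrite // coprimeXl ?prime_coprime.
move=> p p_pr _; exists N; split=> // g pg.
by apply: inf_divisible_height => //; apply: in_pcompX.
Qed.

(** [N] is the product of the bounds over the listed primes; where the first Ulm factor is trivial,
    any [N] works. *)
Lemma ulm_exponent (s : seq nat) :
  (forall p, prime p -> ulm_nontrivial G p -> p \in s) ->
  (forall p, prime p -> ulm_nontrivial G p -> ulm_bounded G p) ->
  exists2 N, 0 < N & forall p g, prime p -> in_pcomp p g -> inf_height p (g ^+ N).
Proof.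
move=> ulm_s bdd.
have [N N_gt0 hN] : exists2 N, 0 < N &
    forall p g, prime p -> p \in s -> in_pcomp p g -> inf_height p (g ^+ N).
  elim: s {ulm_s} => [|q s [N N_gt0 hN]]; first by exists 1%N.
  have [[q_pr qbdd]|nq] := pselect (prime q /\ ulm_nontrivial G q).
    have [M [M_gt0 hM]] := bdd q q_pr qbdd.
    exists (M * N)%N; first by rewrite muln_gt0 M_gt0.
    move=> p g p_pr; rewrite inE => /orP[/eqP->|ps] pg.
      by rewrite expgnA; apply/inf_heightX/hM.
    by rewrite mulnC expgnA; apply/inf_heightX/hN.
  exists N => // p g p_pr; rewrite inE => /orP[/eqP pq|ps] pg; last exact: hN.
  apply: inf_heightX; apply: contrapT => hg; apply: nq.
  by rewrite -pq; split=> //; exists g.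
exists N => // p g p_pr pg; apply: contrapT => hg.
have ps : p \in s by apply: ulm_s => //; exists (g ^+ N); split; first exact: in_pcompX.
exact/hg/hN.
Qed.

(** * Divisibility and centrality of the [N]-th powers *)

Section DivisiblePart.
Hypotheses (perG : periodic_group G) (nilG : nilpotent_group G).
Variable N : nat.
Hypothesis N_gt0 : 0 < N.
Hypothesis heightN : forall p g, prime p -> in_pcomp p g -> inf_height p (g ^+ N).

Lemma powers_prime_divisible g p : prime p -> exists h, g ^+ N = (h ^+ N) ^+ p.
Proof.
move=> p_pr; have [c Gc] := nilG; have [n [n_gt0 gn]] := perG g.
have [q co_pq def_n] := pfactor_coprime p_pr n_gt0.
have q_gt0 : 0 < q by move: n_gt0; rewrite def_n muln_gt0 => /andP[].
have pgq : in_pcomp p (g ^+ q) by exists (logn p n); rewrite -expgnA -def_n.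
(* The factor [n ^ c] in the degree makes [t ^+ (n ^ c)] commute with [g]. *)
have [|t gqN] := inf_height_divisible p_pr (heightN p_pr pgq) (N := (n ^ c * (N * p))%N).
  by rewrite !muln_gt0 expn_gt0 n_gt0 N_gt0 prime_gt0.
have com_tg := commute_expg_order t Gc gn.
have [u v uv _] := egcdnP p q_gt0.
(* Since [u * q = v * p + 1], the power [N * p] of this element is [g] to the exponent
   [N * (u * q - v * p) = N]. *)
exists (t ^+ (n ^ c) ^+ u * g^-1 ^+ v).
have com_uv : commute (t ^+ (n ^ c) ^+ u) (g^-1 ^+ v).
  by apply: commuteX2; apply: commuteV.
rewrite -expgnA expgMn // -expgnA (mulnC u) expgnA -[_ ^+ _ ^+ (N * p)]expgnA -gqN.
rewrite !expVgn -!expgnA; apply: (mulIg (g ^+ (v * (N * p)))).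
rewrite mulgVK -expgnDr; congr (g ^+ _).
by rewrite mulnCA [RHS]mulnCA (mulnC q) uv gcdnC (eqP co_pq) mulnDr muln1 addnC.
Qed.

Lemma powers_divisible g m : 0 < m -> exists h, g ^+ N = (h ^+ N) ^+ m.
Proof.
elim/ltn_ind: m g => m IH g m_gt0; have [m_le1|m_gt1] := leqP m 1.
  by exists g; rewrite (_ : m = 1%N) //; apply/eqP; rewrite eqn_leq m_le1.
have [h ->] := powers_prime_divisible g (pdiv_prime m_gt1).
have [||k ->] := IH (m %/ pdiv m) _ h.
- by rewrite ltn_Pdiv ?prime_gt1 ?pdiv_prime.
- by rewrite divn_gt0 ?pdiv_gt0 // dvdn_leq ?pdiv_dvd.
by exists k; rewrite -expgnA divnK ?pdiv_dvd.
Qed.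

(** With [x ^+ r = 1], [g ^+ N] is an [r ^ c]-th power, and these commute with [x]. *)
Lemma powers_central g x : commute (g ^+ N) x.
Proof.
have [c Gc] := nilG; have [r [r_gt0 xr]] := perG x.
have [|h ->] := @powers_divisible g (r ^ c); first by rewrite expn_gt0 r_gt0.
exact: commute_expg_order.
Qed.

Definition is_power g := exists h, g = h ^+ N.

Lemma is_power_normal : normal_subgroup is_power.
Proof.
split=> [|_ _ [g ->] [h ->]|_ [g ->]|_ x [g ->]].
- by exists 1; rewrite expg1n.
(* The bases are chosen as [N]-th powers, so they are central and the product is again an [N]-th
   power. *)
- have [g' ->] := powers_divisible g N_gt0; have [h' ->] := powers_divisible h N_gt0.
  by exists (g' ^+ N * h' ^+ N); rewrite expgMn //; apply: powers_central.
- by exists g^-1; rewrite expVgn.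
- by exists (g ^ x); rewrite conjXg.
Qed.

Lemma solvable_of_exponent (I : eqType) (J : Type) (sys : I -> word G J) :
  unimodular sys -> has_solution sys.
Proof.
move=> uni; have nP := is_power_normal; have nU i := iter_central_mod_normal i nP.
(* The final lift, from the divisible subgroup of [N]-th powers to 1, is peeled off first. *)
apply: (lift_solution (q := 0) (@trivial_normal G) nP) => //.
- by move=> _ ->; apply: normal1.
- by move=> _ [g ->] x; apply/eqP/commgP/powers_central.
- right; split=> // _ n [g ->] n_gt0; have [h ->] := powers_divisible g n_gt0.
  by exists (h ^+ N) => //; exists h.
have PU i g : is_power g -> iter i (@central_mod G) is_power g.
  by move=> Pg; elim: i => //= i; apply: sub_central_mod.
have [c Gc] := nilG.
have U_top i g : upper_central i g -> iter i (@central_mod G) is_power g.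
  elim: i g => [|i IH] g /=; first by move=> ->; apply: normal1.
  by move=> Zg x; apply/IH/Zg.
have : exists s, forall i, iter c (@central_mod G) is_power (word_eval s (sys i)).
  (* The top term of the series is all of [G], so any substitution is a solution modulo it. *)
  by exists (fun=> 1) => i; apply: U_top.
elim: c {Gc U_top} => //= c IH sol; apply: IH.
apply: (lift_solution_exponent (N := N)) sol => //.
- exact: (nU c.+1).
- by move=> g; apply: sub_central_mod.
- by move=> g _; apply: PU; exists g.
Qed.
End DivisiblePart.
End UlmFactors.

Theorem theorem1 (G : groupType) :
  periodic_group G -> nilpotent_group G ->
  ((forall (I J : Type) (sys : I -> word G J), unimodular sys -> has_solution sys)
   <->
   ((exists L : seq nat, forall p : nat, prime p -> ulm_nontrivial G p -> p \in L) /\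
    (forall p : nat, prime p -> ulm_nontrivial G p -> ulm_bounded G p))).
Proof.
move=> perG nilG; split=> [solG|[[s ulm_s] bdd] I J sys uni].
  have [N [N_gt0 divN]] := solvable_bounded perG nilG (solG nat nat).
  exact: bounded_ulm divN.
have [N N_gt0 heightN] := ulm_exponent ulm_s bdd.
(* [{classic I}] gives the index type the decidable equality used to collect repeated equations. *)
exact: (solvable_of_exponent perG nilG N_gt0 heightN (I := {classic I}) uni).
Qed.
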